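(* Let $n\ge 4$ and let $\|\cdot\|$ be any norm on $\mathbb{R}^n$. Then there is $c_n=c_n(\|\cdot\|)>0$ such that for any $c\in[0,c_n]$ we have $$\dim_H FS_n(\|\cdot\|,c)\ \ge\ n-2 .$$ In particular, the Dirichlet spectrum $$\mathcal{D}_n(\|\cdot\|)=\{\Theta(\|\cdot\|,\boldsymbol{\xi}):\boldsymbol{\xi}\in\mathbb{R}^n\}\subseteq[0,D]$$ contains some right neighborhood of $0$, and for each $c\in[0,c_n]$ we have $\dim_H DI_n(\|\cdot\|,c)\ge n-2$.
   Context: For $\boldsymbol{\xi}\in\mathbb{R}^n$ (a linear form in $n$ variables), a norm $\|\cdot\|$ on $\mathbb{R}^n$ and $t\ge1$ let $$\psi_{\boldsymbol{\xi}}(\|\cdot\|,t)=\min\{|\xi_1b_1+\cdots+\xi_nb_n+b_{n+1}| : b_1,\dots,b_{n+1}\in\mathbb{Z},\ 1\le \|(b_1,\dots,b_n)\|\le t\},$$ $\Theta(\|\cdot\|,\boldsymbol{\xi})=\limsup_{t\to\infty}t^{n}\psi_{\boldsymbol{\xi}}(\|\cdot\|,t)$, $\widetilde\Theta(\|\cdot\|,\boldsymbol{\xi})=\liminf_{t\to\infty}t^{n}\psi_{\boldsymbol{\xi}}(\|\cdot\|,t)$, and $D=\sup_{\boldsymbol{\xi}\in\mathbb{R}^n}\Theta(\|\cdot\|,\boldsymbol{\xi})<\infty$. Put $DI_n(\|\cdot\|,c)=\{\boldsymbol{\xi}\in\mathbb{R}^n:\Theta(\|\cdot\|,\boldsymbol{\xi})=c\}$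 and $Bad_{1,n}=\{\boldsymbol{\xi}\in\mathbb{R}^n:\widetilde\Theta(\|\cdot\|,\boldsymbol{\xi})>0\}$ (independent of the norm), and $$FS_n(\|\cdot\|,c)=DI_n(\|\cdot\|,c)\setminus Bad_{1,n}.$$ $\dim_H$ denotes Hausdorff dimension. *)

(* Defs.v *)
From mathcomp Require Import all_boot all_order all_algebra.
From mathcomp Require Import all_classical all_reals all_analysis.

Set Implicit Arguments.
Unset Strict Implicit.
Unset Printing Implicit Defensive.

Import Order.TTheory GRing.Theory Num.Theory numFieldNormedType.Exports.

Local Open Scope classical_set_scope.
Local Open Scope ring_scope.

(* Nonnegativity and N 0 = 0 follow from these three axioms. *)
Record is_norm (R : realType) (n : nat) (N : 'rV[R]_n -> R) : Prop := IsNorm {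
  is_norm_definite : forall x, N x = 0 -> x = 0;
  is_norm_homogeneous : forall (a : R) x, N (a *: x) = `|a| * N x;
  is_norm_triangle : forall x y, N (x + y) <= N x + N y }.

Section HausdorffDimension.
Variables (R : realType) (T : Type) (d : T -> T -> R).
Implicit Types (A U : set T) (s delta : R).
Local Open Scope ereal_scope.

(* The point 0 is added so that the diameter of the empty set is 0, not -oo. *)
Definition diam U : \bar R :=
  ereal_sup (0 |` [set (d x y)%:E | x in U & y in U]).

Definition delta_covers delta A : set (nat -> set T) :=
  [set U | A `<=` \bigcup_i U i /\ forall i, diam (U i) <= delta%:E].

Definition hausdorff_premeasure s delta A : \bar R :=
  ereal_inf [set \sum_(i <oo) (diam (U i) `^ s) | U in delta_covers delta A].

(* The premeasure is nonincreasing in delta, so this supremum is the limit as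
   delta tends to 0 from the right. *)
Definition hausdorff_measure s A : \bar R :=
  ereal_sup [set hausdorff_premeasure s delta A | delta in [set e | (0 < e)%R]].

(* Only s > 0 is used: in the library 0 `^ 0 = 1, so for s = 0 the empty members
   of a cover would be counted.  Omitting s = 0 does not change the infimum. *)
Definition hausdorff_dim A : \bar R :=
  ereal_inf [set s%:E | s in [set s | (0 < s)%R /\ hausdorff_measure s A = 0]].

End HausdorffDimension.

Definition euclidean_dist (R : realType) (n : nat) (x y : 'rV[R]_n) : R :=
  Num.sqrt (\sum_(i < n) (x 0 i - y 0 i) ^+ 2).

Notation dimH A := (hausdorff_dim (@euclidean_dist _ _) A).

Section Dirichlet.
Variables (R : realType) (n : nat) (N : 'rV[R]_n -> R).
Implicit Types (xi : 'rV[R]_n) (t c : R).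
Local Open Scope ereal_scope.

Definition admissible t : set ('rV[int]_n * int) :=
  [set b | (1 <= N (map_mx intr b.1) <= t)%R].

(* The coefficients are (b_1, ..., b_n) = b.1 and b_(n+1) = b.2.  When N is a norm
   and admissible t is nonempty, the infimum is a minimum, since only finitely many
   b.1 are admissible; it is +oo when admissible t is empty, which happens only
   for bounded t (if n > 0) and does not affect the upper and lower limits. *)
Definition psi xi t : \bar R :=
  ereal_inf [set `|\sum_(i < n) xi 0%R i * (b.1 0%R i)%:~R + b.2%:~R|%R%:E
            | b in admissible t].

Definition Theta xi : \bar R :=
  limf_esup (fun t => (t ^+ n)%:E * psi xi t) (pinfty_nbhs R).

Definition Theta_low xi : \bar R :=
  limf_einf (fun t => (t ^+ n)%:E * psi xi t) (pinfty_nbhs R).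

Definition dirichlet_spectrum : set (\bar R) := range Theta.

Definition dirichlet_sup : \bar R := ereal_sup dirichlet_spectrum.

Definition DI c : set 'rV[R]_n := [set xi | Theta xi = c%:E].

Definition Bad : set 'rV[R]_n := [set xi | 0 < Theta_low xi].

Definition FS c : set 'rV[R]_n := DI c `\` Bad.

End Dirichlet.

(* Main.v *)
(** Two coordinates x, y of xi are Liouville-type numbers with convergents p_k/q_k and
    r_k/s_k, q_k < s_k < q_(k+1), tuned so that (q_k x - p_k) N(s_k e_2)^n tends to c while
    s_k y - r_k is far smaller than q_(k+1)^-n.  Whatever the other coordinates are, the
    points q_k e_1 and s_k e_2 alone give Theta <= c and Theta_low = 0.  Just below the height
    N(s_k e_2), no integer point supported on the first two coordinates beats q_k e_1.  The
    remaining n - 2 coordinates are chosen uniformly in the unit cube: a union bound over the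
    O(s_k^n) other integer points shows that, for small c, with probability at least 1/2
    none of them beats q_k e_1 either.  By the reverse Fatou lemma this happens for infinitely
    many k with probability at least 1/2, hence Theta = c on a set whose projection to
    n - 2 coordinates has positive measure, and its dimension is at least n - 2. *)
Require Import Defs.
From mathcomp Require Import all_boot all_order all_algebra.
From mathcomp Require Import all_classical all_reals all_analysis measurable_realfun.
From mathcomp Require Import lra ring zify.

Set Implicit Arguments.
Unset Strict Implicit.
Unset Printing Implicit Defensive.

Import Order.TTheory GRing.Theory Num.Theory numFieldNormedType.Exports.

Local Open Scope classical_set_scope.
Local Open Scope ring_scope.

(** * Uniform probability on the unit interval and the unit cube *)

Lemma measurable_exists_int d (T : measurableType d) (P : int -> set T) :
  (forall z, measurable (P z)) -> measurable [set w | exists z, P z w].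
Proof.
move=> mP.
rewrite (_ : [set _ | _] = \bigcup_n (P (Posz n) `|` P (Negz n))); last first.
  apply/seteqP; split=> [w [[n|n] Pw]|w [n _ [Pw|Pw]]]; rewrite /=.
  - by exists n => //; left.
  - by exists n => //; right.
  - by exists (Posz n).
  - by exists (Negz n).
by apply: bigcup_measurable => n _; apply: measurableU.
Qed.

Lemma uniform_prob01E (R : realType) (U : set R) : measurable U ->
  uniform_prob (@ltr01 R) U = lebesgue_measure (U `&` `[0, 1]).
Proof.
move=> mU; rewrite /uniform_prob integral_uniform_pdf.
rewrite (eq_integral (cst 1%E)); last first.
  move=> x; rewrite inE/= in_itv/= => -[_ x01].
  by rewrite /uniform_pdf x01 subr0 invr1.
by rewrite integral_cst ?mul1e//; exact: measurableI.
Qed.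

Lemma lebesgue_measure_near (R : realType) (c r : R) : 0 <= r ->
  lebesgue_measure [set x : R | `|x - c| <= r] = (2 * r)%:E.
Proof.
move=> r0; rewrite (_ : [set _ | _] = `[c - r, c + r]%classic); last first.
  by apply/seteqP; split=> x /=; rewrite in_itv/= ler_distl.
rewrite lebesgue_measure_itv/= lte_fin; case: ltP => cr.
  by rewrite -EFinB; congr (_%:E); ring.
have -> : r = 0 by lra.
by rewrite mulr0.
Qed.

Lemma measurable_near (R : realType) (c r : R) : measurable [set x : R | `|x - c| <= r].
Proof.
rewrite (_ : [set _ | _] = `[c - r, c + r]%classic); first exact: measurable_itv.
by apply/seteqP; split=> x /=; rewrite in_itv/= ler_distl.
Qed.

Lemma measurable_norm_lt d (T : measurableType d) (R : realType) (f : T -> R) (r : R) :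
  measurable_fun setT f -> measurable [set w | `|f w| < r].
Proof.
move=> mf; rewrite (_ : [set _ | _] = setT `&` f @^-1` `]- r, r[%classic).
  by apply: mf => //; exact: measurable_itv.
by rewrite setTI; apply/seteqP; split=> w /=; rewrite in_itv/= ltr_norml.
Qed.

(** As x runs over [0, 1], b x + al runs over an interval of length |b|. If dl <= 1/2, at most |b| +
    2 integers z matter, each contributing an interval of length 2 dl / |b|, in total at most 6 dl.
    If dl > 1/2, the bound exceeds 1. *)
Lemma uniform_prob_near_int (R : realType) (b : int) (al dl : R) :
  b != 0 -> 0 <= dl ->
  (uniform_prob (@ltr01 R) [set x | exists z : int, (`|b%:~R * x + al + z%:~R| < dl)%R]
     <= (6 * dl)%:E)%E.
Proof.
move=> b0 dl0; set U := [set _ | _].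
have mU : measurable U.
  apply: measurable_exists_int => z; apply: measurable_norm_lt.
  by apply: measurable_funD => //; apply: measurable_funD => //; apply: measurable_funM.
have [dlh|dlh] := lerP dl (2^-1); last first.
  apply: (@le_trans _ _ 1%E); first exact: probability_le1.
  by rewrite lee_fin; lra.
rewrite uniform_prob01E//.
pose B : R := `|b|%N%:R.
have normb : `|b%:~R : R| = B by rewrite /B natr_absz intr_norm.
have B1 : 1 <= B by rewrite /B ler1n absz_gt0.
have bB : - B <= b%:~R <= B by rewrite -ler_norml normb.
(* [m0] is the minimum of b x on [0, 1], so every relevant -z exceeds [lo]. The two extra integers
   account for 2 dl <= 1 and for rounding [lo] down. *)
pose m0 : R := if 0 <= b then 0 else b%:~R.
pose lo : R := al + m0 - dl.
pose z0 := Num.floor lo.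
pose ball (j : nat) := [set x : R | `|x - ((z0%:~R + j%:R - al) / b%:~R)| <= dl / B].
have br0 : b%:~R != 0 :> R by rewrite intr_eq0.
have sub : U `&` `[0, 1] `<=` \big[setU/set0]_(j < `|b|.+2) ball j.
  move=> x [[z zx]]; rewrite /= in_itv/= => /andP[x0 x1].
  have [/= lo_le lo_lt] := (floor_le_tmp lo, floorD1_gt lo).
  have bx : m0 <= b%:~R * x <= m0 + B.
    rewrite /m0; case: ifPn => [b_ge0|b_lt0].
      have : 0 <= b%:~R :> R by rewrite ler0z.
      rewrite /B natr_absz ger0_norm// => b0r.
      by rewrite mulr_ge0//= add0r ler_piMr.
    have : b%:~R < 0 :> R by rewrite ltrz0 ltNge.
    rewrite /B natr_absz ltr0_norm ?ltNge// intrN => b0r.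
    by rewrite subrr; apply/andP; split; nra.
  move: zx; rewrite ltr_norml => /andP[zx1 zx2].
  have z0z : z0 <= - z.
    rewrite -ltzD1 -(ltr_int R) intrD intrN mulr1z.
    by move: bx lo_le; rewrite -/z0 => /andP[? ?]; rewrite {1}/lo => ?; lra.
  pose j := `|- z - z0|%N.
  have jE : (j%:R : R) = - z%:~R - z0%:~R.
    by rewrite /j natr_absz ger0_norm ?subr_ge0// intrB intrN.
  have jlt : (j < `|b|.+2)%N.
    rewrite -(ltr_nat R) jE -addn2 natrD -/B.
    by move: bx lo_lt; rewrite -/z0 intrD mulr1z => /andP[? ?]; rewrite {1}/lo => ?; lra.
  rewrite -bigcup_mkord; exists j => //.
  rewrite /ball/= jE (_ : _ - _ = (b%:~R * x + al + z%:~R) / b%:~R); last first.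
    by field.
  by rewrite normrM normfV normb ler_pM2r ?invr_gt0 ?(lt_le_trans _ B1)// ltW// ltr_norml zx1.
have mball j : measurable (ball j) by exact: measurable_near.
have dB : 0 <= dl / B by rewrite divr_ge0// (le_trans _ B1).
apply: (@le_trans _ _ (lebesgue_measure (\big[setU/set0]_(j < `|b|.+2) ball j))).
  apply: le_measure; rewrite ?inE//.
    by apply: measurableI => //; exact: measurable_itv.
  by apply: bigsetU_measurable => j _; exact: mball.
apply: le_trans; first by apply: Boole_inequality => j _; exact: mball.
rewrite (eq_bigr (fun=> (2 * (dl / B))%:E)); last by move=> i _; exact: lebesgue_measure_near.
rewrite sumEFin lee_fin sumr_const card_ord -[leLHS]mulr_natr -(addn2 `|b|%N) natrD -/B.
have dBB : dl / B * B = dl by rewrite divfK// gt_eqF// (lt_le_trans _ B1).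
have : dl / B <= dl by rewrite ler_pdivrMr ?(lt_le_trans _ B1)//; nra.
rewrite (_ : _ * (B + _) = 2 * (dl / B * B) + 4 * (dl / B)); last by ring.
rewrite dBB; lra.
Qed.

(** Tonelli: integrate the bound over either family of sections. For the second family, uniqueness
    of the product measure allows the order of integration to be exchanged. *)
Lemma le_product_measure_section d1 d2 (T1 : measurableType d1) (T2 : measurableType d2)
    (R : realType) (P1 : probability T1 R) (P2 : probability T2 R)
    (A : set (T1 * T2)) (c : \bar R) : measurable A ->
  (forall x, (P2 (xsection A x) <= c)%E) \/ (forall y, (P1 (ysection A y) <= c)%E) ->
  ((P1 \x P2) A <= c)%E.
Proof.
move=> mA [Ac|Ac].
  have c0 : (0 <= c)%E by exact: le_trans (Ac point).
  apply: (@le_trans _ _ (\int[P1]_x (cst c x))%E).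
    apply: ge0_le_integral => //.
      exact: measurable_fun_xsection.
    by move=> x _; exact: Ac.
  by rewrite integral_cst// [X in (_ * X)%E]probability_setT mule1.
have -> : ((P1 \x P2) A = (P1 \x^ P2) A)%E.
  by apply: product_measure_unique => // U V mU mV; exact: product_measure2E.
have c0 : (0 <= c)%E by exact: le_trans (Ac point).
apply: (@le_trans _ _ (\int[P2]_x (cst c x))%E).
  apply: ge0_le_integral => //.
    exact: measurable_fun_ysection.
  by move=> x _; exact: Ac.
by rewrite integral_cst// [X in (_ * X)%E]probability_setT mule1.
Qed.

Lemma measurable_box d (T : measurableType d) (R : realType) (X : nat -> T -> R) (m : nat)
    (a : nat -> R) (r : R) : (forall i, measurable_fun setT (X i)) ->
  measurable [set w | forall i, (i < m)%N -> (`|X i w - a i| <= r)%R].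
Proof.
move=> mX; rewrite (_ : [set w | _] =
    \bigcap_(i in [set i | (i < m)%N]) (setT `&` X i @^-1` [set x | `|x - a i| <= r])).
  by apply: bigcap_measurableType => i im; apply: mX => //; exact: measurable_near.
by apply/seteqP; split=> w wB i im //=; have := wB i im => //; case.
Qed.

(* A uniform point of the unit cube of dimension m, of which only the two bounds
   below are retained: the first makes sets of small diameter improbable, the
   second makes it improbable that an integral linear form is nearly integral. *)
Lemma uniform_cube (R : realType) (m : nat) :
  exists d (T : measurableType d) (P : probability T R) (X : nat -> T -> R),
  [/\ forall i, measurable_fun setT (X i),
      forall (a : nat -> R) (r : R), 0 <= r ->
        (P [set w | forall i, (i < m)%N -> (`|X i w - a i| <= r)%R] <= ((2 * r) ^+ m)%:E)%E &
      forall (b : nat -> int) (al dl : R), 0 <= dl ->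
        (exists2 i, (i < m)%N & b i != 0) ->
        (P [set w | exists z : int,
             (`|\sum_(i < m) (b i)%:~R * X i w + al + z%:~R| < dl)%R] <= (6 * dl)%:E)%E].
Proof.
elim: m => [|m [d [T [P [X [mX Xbox Xint]]]]]].
  exists _, unit, (dirac tt : probability _ R), (fun _ _ => 0).
  split=> [i|a r r0|b al dl dl0 [i]] //.
  by rewrite expr0 probability_le1.
pose X' (i : nat) (w : R * T) := if i is j.+1 then X j w.2 else w.1.
have mX' i : measurable_fun setT (X' i).
  case: i => [|i] /=; first exact: measurable_fst.
  exact: measurableT_comp (mX i) measurable_snd.
pose U : probability _ R := uniform_prob (@ltr01 R).
pose P' : probability _ R := (U \x P)%E.
exists _, _, P', X'; split => // [a r r0|b al dl dl0 [i im bi0]].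
  set B := [set w | forall i, (i < m)%N -> (`|X i w - a i.+1| <= r)%R].
  have mB : measurable B by exact: (measurable_box m (fun i => a i.+1) r mX).
  rewrite (_ : [set w | _] = [set x : R | `|x - a 0| <= r] `*` B); last first.
    apply/seteqP; split=> [w wa|w [w1 w2] [|i] im] //=; last exact: w2.
    by split=> [|i im]; [exact: (wa 0)|exact: (wa i.+1)].
  rewrite [leLHS]product_measure1E//; last exact: measurable_near.
  rewrite exprS EFinM lee_pmul//; last exact: (Xbox (fun i => a i.+1)).
  rewrite [leLHS](uniform_prob01E (measurable_near (a 0) r)).
  rewrite -(lebesgue_measure_near (a 0) r0).
  by apply: le_measure => //; rewrite inE; [apply: measurableI => //|]; exact: measurable_near.
set S := [set w | _].
have mS : measurable S.
  apply: measurable_exists_int => z; apply: measurable_norm_lt.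
  apply: measurable_funD => //; apply: measurable_funD => //.
  apply: measurable_sum => j; apply: measurable_funM => //; exact: mX'.
apply: le_product_measure_section => //.
(* If the first coefficient vanishes, freeze the first coordinate and use the induction hypothesis;
   otherwise freeze the others and use the one-variable estimate. *)
have [b00|b00] := eqVneq (b 0) 0; [left=> x|right=> y].
  rewrite (_ : xsection S x = [set w | exists z : int,
      (`|\sum_(i < m) (b i.+1)%:~R * X i w + al + z%:~R| < dl)%R]).
    apply: (Xint (fun i => b i.+1)) => //; case: i im bi0 => [|i] im; first by rewrite b00 eqxx.
    by exists i.
  apply/seteqP; split=> w; rewrite /xsection/= inE/= => -[z zw]; exists z;
    by move: zw; rewrite big_ord_recl/= b00 mul0r add0r.
pose al' := \sum_(i < m) (b i.+1)%:~R * X i y + al.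
rewrite (_ : ysection S y = [set x | exists z : int, (`|(b 0)%:~R * x + al' + z%:~R| < dl)%R]).
  exact: uniform_prob_near_int.
by apply/seteqP; split=> w; rewrite /ysection/= inE/= => -[z zw]; exists z;
  move: zw; rewrite big_ord_recl/= /al' !addrA.
Qed.


(** * A lower bound for the Hausdorff dimension *)

(** Mass distribution principle for the image of P under [Y]: if s < m, every cover of A by sets of
    diameter at most 1 satisfies P E <= C * sum of diam^s, so the s-dimensional measure is positive.
    [F] is a measurable set containing the preimage of a ball. *)
Lemma hausdorff_dim_ge (R : realType) (T0 : Type) (dist : T0 -> T0 -> R) (A : set T0)
    (m : nat) d (T : measurableType d) (P : probability T R) (Y : T -> T0)
    (E : set T) (C : R) :
  measurable E -> (0 < P E)%E -> (forall w, E w -> A (Y w)) -> 0 < C ->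
  (forall p r, 0 <= r -> exists F, [/\ measurable F,
     forall w, dist p (Y w) <= r -> F w & (P F <= (C * r ^+ m)%:E)%E]) ->
  (m%:R%:E <= hausdorff_dim dist A)%E.
Proof.
move=> mE PE0 EA C0 PF; apply: le_ereal_inf_tmp => _ [s [s0 Hs0] <-].
rewrite lee_fin leNgt; apply/negP => sm.
suff : (0 < hausdorff_premeasure dist s 1 A)%E.
  apply/negP; rewrite -leNgt -Hs0; apply: ereal_sup_ubound.
  by exists 1 => //=; exact: ltr01.
have PEfin : P E \is a fin_num by exact: fin_num_measure.
apply: (@lt_le_trans _ _ ((C^-1)%:E * P E)%E); first by rewrite mule_gt0// lte_fin invr_gt0.
apply: le_ereal_inf_tmp => _ [U [AU dU] <-].
have diam_fin i : exists2 r, 0 <= r <= 1 & diam dist (U i) = r%:E.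
  have d0 : (0 <= diam dist (U i))%E by apply: ereal_sup_ubound; left.
  have := dU i; case: (diam dist (U i)) d0 => [r| |]//; rewrite !lee_fin => r0 r1.
  by exists r; rewrite ?r0.
have ps i : (0 <= diam dist (U i) `^ s)%E by exact: poweR_ge0.
have /choice[F FP] : forall i, exists F, [/\ measurable F,
     forall w, U i (Y w) -> F w & (P F <= C%:E * diam dist (U i) `^ s)%E].
  (* A nonempty [U i] lies in the ball around any of its points whose radius is the diameter. *)
  move=> i; have [[p Up]|U0] := pselect (exists p, U i p); last first.
    exists set0; split => // [w Uw|]; first by case: U0; exists (Y w).
    by rewrite measure0 mule_ge0// lee_fin ltW.
  have [r /andP[r0 r1] dr] := diam_fin i.
  have [F [mF UF PFle]] := PF p r r0.
  exists F; split => // [w Uw|].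
    apply: UF; rewrite -lee_fin -dr; apply: ereal_sup_ubound; right.
    by exists p => //; exists (Y w).
  apply: (le_trans PFle); rewrite dr poweR_EFin -EFinM lee_fin ler_pM2l//.
  (* For r = 0, the left side vanishes because m > s > 0; for 0 < r <= 1, r^m <= r^s. *)
  move: r0; rewrite le_eqVlt => /predU1P[<-|r0].
    by rewrite expr0n gtn_eqF ?powR_ge0// -(ltr_nat R) (lt_trans s0).
  by rewrite -(powR_mulrn _ (ltW r0)); apply: ger_powR (ltW sm); rewrite r0.
rewrite lee_pdivrMl// -nneseriesZl//.
have mF i : measurable (F i) by have [] := FP i.
apply: (@le_trans _ _ (\sum_(i <oo) P (F i))%E); last first.
  by apply: lee_nneseries => [i _ _|i _]; have [] := FP i.
apply: measure_sigma_subadditive => // w Ew.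
have [i _ Ui] := AU _ (EA _ Ew).
by exists i => //; have [_ + _] := FP i; exact.
Qed.

(** * Comparison of a norm with the coordinates *)

Section Norm.
Variables (R : realType) (n : nat) (N : 'rV[R]_n -> R).
Hypothesis normN : is_norm N.

Let NZ := is_norm_homogeneous normN.
Let ND := is_norm_triangle normN.

Lemma is_norm0 : N 0 = 0.
Proof. by rewrite -(scale0r 0) NZ normr0 mul0r. Qed.

Lemma is_normN x : N (- x) = N x.
Proof. by rewrite -scaleN1r NZ normrN1 mul1r. Qed.

Lemma is_norm_ge0 x : 0 <= N x.
Proof. by have := ND x (- x); rewrite subrr is_norm0 is_normN; lra. Qed.

Lemma is_norm_gt0 x : x != 0 -> 0 < N x.
Proof.
move=> x0; rewrite lt_neqAle is_norm_ge0 andbT eq_sym.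
by apply: contra_neq x0; exact: is_norm_definite.
Qed.

Lemma is_norm_sum I (s : seq I) (F : I -> 'rV[R]_n) :
  N (\sum_(i <- s) F i) <= \sum_(i <- s) N (F i).
Proof.
elim: s => [|i s IHs]; first by rewrite !big_nil is_norm0.
by rewrite !big_cons (le_trans (ND _ _))// lerD2l.
Qed.

Lemma is_norm_le_coord (x : 'rV[R]_n) (r : R) : (forall i, `|x 0 i| <= r) ->
  N x <= r * \sum_i N (delta_mx 0 i).
Proof.
move=> xr; rewrite {1}(row_sum_delta x) (le_trans (is_norm_sum _ _))// mulr_sumr.
by apply: ler_sum => i _; rewrite NZ ler_wpM2r// is_norm_ge0.
Qed.

Lemma coord_le_mx_norm (x : 'rV[R]_n) i : `|x 0 i| <= `|x|.
Proof.
have /mapP[j Hj ->] : `|x 0 i| \in [seq `|x k.1 k.2| | k : 'I_1 * 'I_n].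
  by apply/mapP; exists (0, i); rewrite ?mem_enum.
by rewrite [leRHS]/Num.norm /= mx_normrE; apply/bigmax_geP; right => /=; exists j.
Qed.

Lemma is_norm_continuous : continuous N.
Proof.
pose C := 1 + \sum_i N (delta_mx 0 i).
have C1 : 1 <= C by rewrite lerDl sumr_ge0// => i _; exact: is_norm_ge0.
move=> x; apply/(@cvgrPdist_le _ _ _ (nbhs x)) => e e0.
have eC : 0 < e / C by rewrite divr_gt0// (lt_le_trans _ C1).
apply: filterS (nbhsx_ballx x _ eC) => y; rewrite -ball_normE /= => /ltW xy.
have dxy : N (x - y) <= e.
  apply: le_trans (is_norm_le_coord (fun i => le_trans (coord_le_mx_norm _ i) xy)) _.
  rewrite -mulrA ler_piMr ?(ltW e0)// [leLHS]mulrC ler_pdivrMr ?(lt_le_trans _ C1)// mul1r.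
  by rewrite /C lerDr.
have := ND (x - y) y; have := ND (y - x) x; rewrite !subrK.
rewrite -(is_normN (y - x)) opprB ler_norml; lra.
Qed.

(** The constant is the minimum of [N] on the compact unit sphere of the sup norm, attained by
    continuity and positive by definiteness. *)
Lemma is_norm_ge_coord : exists2 k : R, 0 < k & forall (x : 'rV_n) i, k * `|x 0 i| <= N x.
Proof.
have [[x0 x01]|nosphere] := pselect (exists x : 'rV[R]_n, `|x| = 1); last first.
  exists 1 => // x i; have [->|x0] := eqVneq x 0; first by rewrite mxE normr0 mulr0 is_norm_ge0.
  by case: nosphere; exists (`|x|^-1 *: x); rewrite normrZ normfV normr_id mulVf// normr_eq0.
pose S := [set x : 'rV[R]_n | `|x| = 1].
have cS : compact S.
  apply: bounded_closed_compact.
    by exists 1; split => // M M1 x /= ->; exact: ltW.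
  apply: (@preimage_closed _ _ (fun x : 'rV[R]_n => `|x|) [set 1]).
    by move=> z _; exact: norm_continuous.
  exact: closed_eq.
have [||c Sc cmin] := @EVT_min_rV R n N S _ cS; first by exists x0.
  by apply: continuous_subspaceT; exact: is_norm_continuous.
have c0 : c != 0.
  by apply/eqP => c0; move: Sc; rewrite inE /S /= c0 normr0 => /eqP; rewrite eq_sym oner_eq0.
exists (N c); first exact: is_norm_gt0.
move=> x i; have [->|x0'] := eqVneq x 0; first by rewrite mxE normr0 mulr0 is_norm_ge0.
have nx : 0 < `|x| by rewrite normr_gt0.
apply: (@le_trans _ _ (N c * `|x|)); first by rewrite ler_wpM2l ?is_norm_ge0 ?coord_le_mx_norm.
have : N c <= N (`|x|^-1 *: x).
  by apply: cmin; rewrite inE /S /= normrZ normfV normr_id mulVf// gt_eqF.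
by rewrite NZ normfV normr_id mulrC ler_pdivlMr.
Qed.

End Norm.

(** * Criteria for the upper and lower limits, and Dirichlet's theorem *)

Section DirichletConstants.
Variables (R : realType) (n : nat) (N : 'rV[R]_n -> R).
Implicit Types (xi : 'rV[R]_n) (b : 'rV[int]_n * int).

Definition linear_form xi b : R := \sum_(i < n) xi 0 i * (b.1 0 i)%:~R + b.2%:~R.

Lemma psi_le xi t b : admissible N t b -> (psi N xi t <= `|linear_form xi b|%:E)%E.
Proof. by move=> tb; apply: ereal_inf_lbound; exists b. Qed.

Lemma Theta_le xi (T0 c : R) : 0 <= T0 ->
  (forall t, T0 < t -> exists2 b, admissible N t b & t ^+ n * `|linear_form xi b| <= c) ->
  (Theta N xi <= c%:E)%E.
Proof.
move=> T0_ge0 H; rewrite /Theta limf_esupE.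
apply: (@le_trans _ _ (ereal_sup ((fun t => (t ^+ n)%:E * psi N xi t)%E @` [set t | T0 < t]))).
  by apply: ereal_inf_lbound; exists [set t | T0 < t] => //; exists T0; split=> //; exact: num_real.
apply: ge_ereal_sup => _ [t /= T0t <-]; have [b tb tc] := H t T0t.
apply: le_trans (_ : (t ^+ n * `|linear_form xi b|)%:E <= _)%E; last by rewrite lee_fin.
by rewrite EFinM lee_wpmul2l ?psi_le// lee_fin exprn_ge0// ltW// (le_lt_trans T0_ge0).
Qed.

Lemma Theta_ge xi (c : R) :
  (forall T0, exists2 t, T0 < t &
    forall b, admissible N t b -> c <= t ^+ n * `|linear_form xi b|) ->
  (c%:E <= Theta N xi)%E.
Proof.
move=> H; rewrite /Theta limf_esupE; apply: le_ereal_inf_tmp => _ [V [T0 [_ TV]] <-].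
have [t + tc] := H (Num.max T0 0); rewrite gt_max => /andP[T0t t0].
apply: le_trans (ereal_sup_ubound _); last by exists t => //; exact: TV.
have tn0 : 0 < t ^+ n by rewrite exprn_gt0.
rewrite -lee_pdivrMl//; apply: le_ereal_inf_tmp => _ [b tb <-].
by rewrite -EFinM lee_fin ler_pdivrMl//; exact: tc.
Qed.

Lemma Theta_low_le0 xi :
  (forall T0 e : R, 0 < e ->
    exists t b, [/\ T0 < t, admissible N t b & t ^+ n * `|linear_form xi b| <= e]) ->
  (Theta_low N xi <= 0)%E.
Proof.
move=> H; rewrite /Theta_low limf_einfE; apply: ge_ereal_sup => _ [V [T0 [_ TV]] <-].
apply/lee_addgt0Pr => e e0; rewrite add0e.
have [t [b [+ tb tc]]] := H (Num.max T0 0) e e0; rewrite gt_max => /andP[T0t t0].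
apply: le_trans (ereal_inf_lbound _) _; first by exists t => //; exact: TV.
apply: le_trans (_ : (t ^+ n * `|linear_form xi b|)%:E <= _)%E; last by rewrite lee_fin.
by rewrite EFinM lee_wpmul2l ?psi_le// lee_fin exprn_ge0// ltW.
Qed.

Lemma Theta_ge0 xi : (0 <= Theta N xi)%E.
Proof.
rewrite -[0%E]/(0%R%:E); apply: Theta_ge => T0; exists (Num.max T0 0 + 1).
  by rewrite ltr_pwDr// le_max lexx.
by move=> b _; rewrite mulr_ge0// exprn_ge0// addr_ge0// le_max lexx orbT.
Qed.

(** The (X+1)^n vectors with entries in 0, ..., X have the fractional parts of their forms in X^n
    cells of length X^-n; b is the difference of two vectors sharing a cell. *)
Lemma dirichlet_pigeonhole xi (X : nat) : (0 < n)%N -> (0 < X)%N -> exists b,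
  [/\ b.1 != 0, forall i, `|b.1 0 i| <= X%:Z & `|linear_form xi b| <= (X%:R ^+ n)^-1].
Proof.
move=> n_gt0 X0.
pose L (u : {ffun 'I_n -> 'I_X.+1}) : R := \sum_i xi 0 i * (u i)%:R.
have Xn0 : 0 < X%:R ^+ n :> R by rewrite exprn_gt0// ltr0n.
pose cell u : R := (L u - (Num.floor (L u))%:~R) * X%:R ^+ n.
have cell_ge0 u : 0 <= cell u by rewrite mulr_ge0 ?(ltW Xn0)// subr_ge0 floor_le.
have cell_lt u : (Num.truncn (cell u) < X ^ n)%N.
  rewrite truncn_lt_nat// natrX gtr_pMl//.
  by have := floorD1_gt (L u); rewrite intrD; lra.
pose f u := Ordinal (cell_lt u).
have /injectivePn[u [v uv fuv]] : ~~ injectiveb f.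
  apply/injectiveP => /leq_card; rewrite card_ffun !card_ord leqNgt.
  by rewrite ltn_exp2r ?ltnSn// n_gt0.
exists (\row_i ((u i)%:Z - (v i)%:Z), Num.floor (L v) - Num.floor (L u)); split=> /=.
- apply: contra_neq uv => /rowP b0; apply/ffunP => i; apply/val_inj/eqP.
  by have := b0 i; rewrite !mxE => /eqP; rewrite subr_eq0 eqz_nat.
- move=> i; rewrite mxE ler_norml; move: (ltn_ord (u i)) (ltn_ord (v i)).
  move: (u i : nat) (v i : nat) => y z; lia.
rewrite /linear_form/= (_ : \sum_i _ = L u - L v); last first.
  by rewrite /L -sumrB; apply: eq_bigr => i _; rewrite mxE intrB mulrBr.
have cuv : `|cell u - cell v| <= 1.
  have := truncn_itv (cell_ge0 u); have := truncn_itv (cell_ge0 v).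
  have -> : Num.truncn (cell u) = Num.truncn (cell v) by case: fuv.
  rewrite -!natr1 ler_norml; lra.
rewrite -[leRHS]mul1r ler_pdivlMr// -[X in _ * X](gtr0_norm Xn0) -normrM.
rewrite [leLHS](_ : _ = `|cell u - cell v|)//.
by rewrite /cell -mulrBl intrB; congr (`|_ * _|); ring.
Qed.

End DirichletConstants.

(** * Finiteness of the Dirichlet supremum *)

Section DirichletBound.
Variables (R : realType) (n : nat) (N : 'rV[R]_n -> R).
Hypothesis (normN : is_norm N) (n_gt0 : (0 < n)%N).

(** A nonzero integer vector may have norm below 1, but its norm is at least [k]. Multiplying the
    pigeonhole vector by [K] >= 1/k makes it admissible, at the price of a factor [K] in the
    form. *)
Lemma dirichlet_sup_lty : (dirichlet_sup N < +oo)%E.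
Proof.
have [k k0 kN] := is_norm_ge_coord normN.
pose K := (Num.truncn k^-1).+1.
have K1 : 1 <= K%:R * k by rewrite -ler_pdivrMr// mul1r ltW// truncnS_gt.
have K0 : 0 < K%:R :> R by rewrite ltr0n.
pose S := \sum_i N (delta_mx 0 i).
have S0 : 0 <= S by rewrite sumr_ge0// => i _; exact: is_norm_ge0.
pose C := K%:R * (S + 1).
have C0 : 0 < C by rewrite mulr_gt0// ltr_wpDl.
suff TC xi : (Theta N xi <= (K%:R * (2 * C) ^+ n)%:E)%E.
  apply: le_lt_trans (ltry (K%:R * (2 * C) ^+ n)).
  by apply: ge_ereal_sup => _ [xi _ <-].
apply: (@Theta_le _ _ _ _ C); first exact: ltW.
move=> t Ct; have t0 : 0 < t by exact: lt_trans Ct.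
(* With this [X], the multiplied vector has norm at most K X S <= X C <= t, while t / C < X + 1 <= 2
   X bounds t / X by 2 C. *)
pose X := Num.truncn (t / C).
have tC1 : 1 <= t / C by rewrite ler_pdivlMr// mul1r ltW.
have X0 : (0 < X)%N by rewrite truncn_gt0.
have XR : 0 < X%:R :> R by rewrite ltr0n.
have /andP[Xle Xlt] := truncn_itv (ltW (divr_gt0 t0 C0)).
have [[b b0] [/= bn0 bX bL]] := dirichlet_pigeonhole xi n_gt0 X0.
have [i bi0] : exists i, b 0 i != 0.
  apply/existsP; rewrite -[X in is_true X]negbK negb_exists; apply: contra bn0 => /forallP b0'.
  by apply/eqP/rowP => i; have := b0' i; rewrite negbK mxE => /eqP.
have KbE : map_mx intr (K%:Z *: b) = K%:R *: map_mx intr b :> 'rV[R]_n.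
  by apply/rowP => j; rewrite !mxE intrM.
exists (K%:Z *: b, K%:Z * b0).
  rewrite /admissible/= KbE is_norm_homogeneous// gtr0_norm//; apply/andP; split.
    apply: le_trans K1 _; rewrite ler_pM2l// -[leLHS]mulr1.
    apply: le_trans (kN _ i); rewrite ler_pM2l// mxE -intr_norm ler1z.
    by rewrite -gtz0_ge1 normr_gt0.
  apply: (@le_trans _ _ (K%:R * (X%:R * S))).
    rewrite ler_pM2l//; apply: is_norm_le_coord => // j.
    by rewrite mxE -intr_norm -[leRHS]/((X%:Z)%:~R) ler_int.
  move: Xle; rewrite ler_pdivlMr// => Xle; apply: le_trans Xle.
  rewrite mulrCA ler_pM2l// /C ler_pM2l//; lra.
have -> : linear_form xi (K%:Z *: b, K%:Z * b0) = K%:R * linear_form xi (b, b0).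
  rewrite /linear_form/= mulrDr mulr_sumr intrM; congr (_ + _).
  by apply: eq_bigr => j _; rewrite mxE intrM mulrCA.
rewrite normrM gtr0_norm// mulrCA ler_pM2l//.
apply: (@le_trans _ _ (t ^+ n * (X%:R ^+ n)^-1)); first by rewrite ler_pM2l ?exprn_gt0.
have C2_ge0 : 0 <= 2 * C by rewrite mulr_ge0// ltW.
rewrite -expr_div_n lerXn2r ?nnegrE ?divr_ge0 ?(ltW t0) ?(ltW XR)//.
rewrite ler_pdivrMr// mulrAC -ler_pdivrMr// (le_trans (ltW Xlt))//.
have : 1 <= X%:R :> R by rewrite ler1n.
rewrite -[X.+1%:R]natr1; lra.
Qed.

End DirichletBound.

(** * Construction of the two Liouville-type numbers *)

(** The point is the supremum of the left ends; their strict increase makes the left inequality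
    strict, which later makes the approximation errors positive. *)
Lemma nested_intervals (R : realType) (lo hi : nat -> R) :
  (forall k, lo k < lo k.+1) -> (forall k, hi k.+1 <= hi k) -> (forall k, lo k <= hi k) ->
  exists x, forall k, lo k < x <= hi k.
Proof.
move=> loS hiS lohi.
have lo_homo : {homo lo : i j / (i <= j)%N >-> i <= j}.
  by apply: homo_leq => // [y x z|k]; [exact: le_trans|exact: ltW].
have hi_homo : {homo hi : i j / (i <= j)%N >-> j <= i}.
  by apply: homo_leq => // y x z xy yz; exact: le_trans xy.
have lohi' i j : lo i <= hi j.
  apply: le_trans (lo_homo _ _ (leq_maxl i j)) _.
  exact: le_trans (lohi _) (hi_homo _ _ (leq_maxr i j)).
exists (sup (range lo)) => k; apply/andP; split.
  apply: lt_le_trans (loS k) _; apply: ub_le_sup; last by exists k.+1.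
  by exists (hi 0) => _ [i _ <-].
by apply: ge_sup => [|_ [i _ <-] //]; exists (lo 0); exists 0.
Qed.

(** One stage of the construction: the fraction p/q approximates x and r/s approximates y. *)
Record rational_pair := RationalPair { rp_q : nat; rp_p : nat; rp_s : nat; rp_r : nat }.

(* The denominators are powers of 2 and of 3, which makes them coprime. *)
Definition reduced_pair st := [/\ exists2 a, (0 < a)%N & rp_q st = (2 ^ a)%N, odd (rp_p st),
  exists2 e, (0 < e)%N & rp_s st = (3 ^ e)%N, ~~ (3 %| rp_r st)%N & (rp_q st < rp_s st)%N].

Lemma reduced_pair_coprime st : reduced_pair st ->
  [/\ coprime (rp_p st) (rp_q st), coprime (rp_r st) (rp_s st) & coprime (rp_q st) (rp_s st)].
Proof.
move=> [[a a0 ->] op [e e0 ->] r3 _]; split.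
- by rewrite coprimeXr// coprimen2.
- by rewrite coprimeXr// coprime_sym prime_coprime.
- by rewrite coprimeXl// coprimeXr.
Qed.

Section LiouvillePair.
Variables (R : realType) (n : nat) (M c : R).
Hypotheses (n_gt0 : (0 < n)%N) (M0 : 0 < M) (c0 : 0 <= c) (cM : 2 * c <= M ^+ n).

(** The interval of length 1/q' to the right of p'/q' sits inside the one for p/q, and p'/q' - p/q
    is tuned to c / ((s M)^n q), so that (q x - p) (s M)^n is nearly c. The last two clauses make s
    y - r at most 2 s / s', far below q'^-n. *)
Definition next_pair (st st' : rational_pair) :=
  let q : R := (rp_q st)%:R in let p : R := (rp_p st)%:R in
  let s : R := (rp_s st)%:R in let r : R := (rp_r st)%:R in
  let q' : R := (rp_q st')%:R in let p' : R := (rp_p st')%:R in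
  let s' : R := (rp_s st')%:R in let r' : R := (rp_r st')%:R in
  [/\ (rp_s st < rp_q st')%N,
      [/\ p / q < p' / q', p' / q' + q'^-1 <= p / q + q^-1,
      `|(p' / q' - p / q) - c / (s * M) ^+ n / q| <= q'^-1 & 2 * q * s * (s * M) ^+ n <= q'],
      r' / s' = r / s + s'^-1 & 2 * s ^+ 2 * q' ^+ n <= s'].

(** Take q' = 2^A q and p' = 2^A p + u with u odd, and s' = 3^B s and r' = 3^B r + 1: the new
    fractions stay reduced, and A and B can be as large as the size conditions demand. *)
Lemma next_pair_exists st : reduced_pair st -> exists2 st', reduced_pair st' & next_pair st st'.
Proof.
case: st => q p s r [/= [a a0 qE] op [e e0 sE] r3 qs].
have q0 : (0 < q)%N by rewrite qE expn_gt0.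
have s0 : (0 < s)%N by rewrite sE expn_gt0.
have qR : 0 < q%:R :> R by rewrite ltr0n.
have sR : 0 < s%:R :> R by rewrite ltr0n.
have sMn : 0 < (s%:R * M) ^+ n by rewrite exprn_gt0// mulr_gt0.
pose A := (4 + s + (Num.truncn (2 * s%:R * (s%:R * M) ^+ n)).+1)%N.
have A4 : (4 <= A)%N by rewrite /A -addnA leq_addr.
have sA : (s <= A)%N by rewrite /A addnAC leq_addl.
have A2 : (A < 2 ^ A)%N by rewrite ltn_expl.
pose q' := (q * 2 ^ A)%N.
have q'0 : (0 < q')%N by rewrite muln_gt0 q0 expn_gt0.
have q'R : 0 < q'%:R :> R by rewrite ltr0n.
pose th : R := c / (s%:R * M) ^+ n / q%:R.
have th0 : 0 <= th by rewrite !divr_ge0// ltW.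
(* An odd integer within 1 of [th] q', where [th] is the desired increment of p/q. *)
pose u := (2 * Num.truncn (th * q'%:R / 2)).+1.
have thq0 : 0 <= th * q'%:R / 2 by rewrite divr_ge0// mulr_ge0// ltW.
have uE : th * q'%:R - 1 <= u%:R <= th * q'%:R + 1.
  have -> : u%:R = 2 * (Num.truncn (th * q'%:R / 2))%:R + 1 :> R by rewrite /u -natr1 natrM.
  by have /andP[] := truncn_itv thq0; rewrite -[X in _ < X]natr1; lra.
pose p' := (p * 2 ^ A + u)%N.
pose B := (2 * s ^ 2 * q' ^ n).+1.
have B3 : (B < 3 ^ B)%N by rewrite ltn_expl.
pose s' := (s * 3 ^ B)%N.
pose r' := (r * 3 ^ B + 1)%N.
have s'R : 0 < s'%:R :> R by rewrite ltr0n muln_gt0 s0 expn_gt0.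
have A2_neq0 : (2 ^ A)%:R != 0 :> R by rewrite pnatr_eq0 -lt0n expn_gt0.
have B3_neq0 : (3 ^ B)%:R != 0 :> R by rewrite pnatr_eq0 -lt0n expn_gt0.
have pq' : p'%:R / q'%:R = p%:R / q%:R + u%:R / q'%:R :> R.
  rewrite /p' natrD mulrDl; congr (_ + _).
  by rewrite /q' (natrM _ p) (natrM _ q) invfM mulrACA (divff A2_neq0) mulr1.
exists (RationalPair q' p' s' r').
  split => /=.
  - by exists (a + A)%N; rewrite ?addn_gt0 ?a0// /q' qE expnD.
  - by rewrite /p' oddD oddM oddX /= andbF /= /u /= mul2n odd_double.
  - by exists (e + B)%N; rewrite ?addn_gt0 ?e0// /s' sE expnD.
  - by rewrite /r' dvdn_addr// dvdn_mull// expnS dvdn_mulr.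
  - rewrite /s'; apply: (@leq_trans (1 * 3 ^ B)); last by rewrite leq_mul.
    rewrite mul1n; apply: leq_trans B3; rewrite ltnS /B.
    apply: leq_trans (leqnSn _); rewrite -[X in (X <= _)%N]mul1n leq_mul//.
      by rewrite muln_gt0 expn_gt0 s0.
    by rewrite -[X in (X <= _)%N]expn1 leq_pexp2l.
split=> /=.
- rewrite /q'; apply: (@leq_trans (1 * 2 ^ A)); last by rewrite leq_mul.
  by rewrite mul1n (leq_ltn_trans sA A2).
- split.
  + by rewrite pq' ltrDl divr_gt0// ltr0n.
  + rewrite pq' -addrA lerD2l -[X in _ + X <= _]mul1r -mulrDl ler_pdivrMr//.
    have /andP[_ uL] := uE; rewrite mulrC.
    have q'q : q'%:R / q%:R = (2 ^ A)%:R :> R by rewrite /q' natrM mulrAC divff ?mul1r ?gt_eqF.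
    (* By 2 c <= M^n the increment uses at most half of the available interval, and 2^A >= 4 absorbs
       the rounding of [u]. *)
    rewrite q'q; have thA : th * q'%:R <= (2 ^ A)%:R / 2.
      rewrite /th -mulrA [_^-1 * _]mulrC q'q [leRHS]mulrC; apply: ler_wpM2r => //.
      rewrite ler_pdivrMr// exprMn.
      have : 1 <= s%:R ^+ n :> R by rewrite exprn_ege1// ler1n.
      move=> s1; have := ler_peMl (ltW (exprn_gt0 n M0)) s1; move: cM; lra.
    have : 4 <= (2 ^ A)%:R :> R by rewrite ler_nat (leq_trans A4 (ltnW A2)).
    lra.
  + rewrite pq' [p%:R / q%:R + _]addrC addrK -/th -{1}(mulfK (lt0r_neq0 q'R) th) -mulrBl normrM.
    rewrite [X in _ * X]gtr0_norm ?invr_gt0// -[leRHS]mul1r ler_pM2r ?invr_gt0//.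
    by rewrite ler_distlC; lra.
  + rewrite /q' natrM -!mulrA [2 * _]mulrCA ler_pM2l// !mulrA.
    apply: le_trans (ltW (truncnS_gt _)) _; rewrite ler_nat (leq_trans _ (ltnW A2))//.
    by rewrite leq_addl.
- rewrite /r' natrD mulrDl mul1r; congr (_ + _).
  by rewrite /s' (natrM _ r) (natrM _ s) invfM mulrACA (divff B3_neq0) mulr1.
- rewrite -!natrX -!natrM ler_nat /s' (leq_trans (leqnSn _))// (leq_trans (ltnW B3))//.
  by rewrite leq_pmull.
Qed.

End LiouvillePair.

(** Iterate [next_pair] from 1/2 and 1/3. The numbers x and y are the common points of the nested
    intervals, and comparing stages k and k + 1 gives the two error estimates. *)
Lemma liouville_pair (R : realType) (n : nat) (M c : R) :
  (0 < n)%N -> 0 < M -> 0 <= c -> 2 * c <= M ^+ n ->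
  exists (x y : R) (q p s r : nat -> nat),
  [/\ forall k, [/\ coprime (p k) (q k), coprime (r k) (s k) & coprime (q k) (s k)],
      forall k, [/\ (k < q k)%N, (q k < s k)%N & (s k < q k.+1)%N],
      forall k, 0 < (q k)%:R * x - (p k)%:R,
      forall k, `|((q k)%:R * x - (p k)%:R) * ((s k)%:R * M) ^+ n - c| <= (s k)%:R^-1 &
      forall k, 0 < (s k)%:R * y - (r k)%:R /\
        ((s k)%:R * y - (r k)%:R) * (q k.+1)%:R ^+ n <= (s k)%:R^-1].
Proof.
move=> n0 M0 c0 cM.
have /choice[f Pf] : forall st : {st | reduced_pair st}, exists st' : {st | reduced_pair st},
    next_pair n M c (sval st) (sval st').
  move=> [st rst] /=; have [st' rst' nst'] := next_pair_exists n0 M0 c0 cM rst.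
  by exists (exist _ st' rst').
have red0 : reduced_pair (RationalPair 2 1 3 1).
  by split => //=; exists 1.
pose st k := sval (iter k f (exist _ _ red0)).
have red k : reduced_pair (st k) := svalP (iter k f (exist _ _ red0)).
have nxt k : next_pair n M c (st k) (st k.+1) := Pf (iter k f (exist _ _ red0)).
pose q k := rp_q (st k); pose p k := rp_p (st k).
pose s k := rp_s (st k); pose r k := rp_r (st k).
have qs k : (q k < s k)%N by have [] := red k.
have sq k : (s k < q k.+1)%N by have [] := nxt k.
have kq k : (k < q k)%N.
  elim: k => [//|k IHk]; apply: leq_ltn_trans IHk _; exact: ltn_trans (qs k) (sq k).
have qR k : 0 < (q k)%:R :> R by rewrite ltr0n (leq_trans _ (kq k)).
have sR k : 0 < (s k)%:R :> R by rewrite ltr0n (leq_trans _ (qs k)).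
have [x xP] : exists x : R, forall k,
    (p k)%:R / (q k)%:R < x <= (p k)%:R / (q k)%:R + (q k)%:R^-1.
  apply: (nested_intervals (lo := fun k => (p k)%:R / (q k)%:R)) => k.
  - by have [_ []] := nxt k.
  - by have [_ []] := nxt k.
  - by rewrite lerDl invr_ge0 ltW.
have ss k : 2 * (s k)%:R ^+ 2 * (q k.+1)%:R ^+ n <= (s k.+1)%:R :> R by have [] := nxt k.
have yE k : (r k.+1)%:R / (s k.+1)%:R = (r k)%:R / (s k)%:R + (s k.+1)%:R^-1 :> R.
  by have [] := nxt k.
have q1 k : 1 <= (q k)%:R :> R by rewrite ler1n (leq_trans _ (kq k)).
have s1 k : 1 <= (s k)%:R :> R by rewrite ler1n (leq_trans _ (qs k)).
have ss2 k : 2 * (s k)%:R <= (s k.+1)%:R :> R.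
  apply: le_trans (ss k); have := s1 k.
  have : 1 <= (q k.+1)%:R ^+ n :> R by rewrite exprn_ege1.
  rewrite expr2; set S := (s k)%:R; set Q := _ ^+ n => Q1 S1.
  have : S <= S * S by nra.
  nra.
have [y yP] : exists y : R, forall k,
    (r k)%:R / (s k)%:R < y <= (r k)%:R / (s k)%:R + (s k)%:R^-1.
  apply: (nested_intervals (lo := fun k => (r k)%:R / (s k)%:R)) => k.
  - by rewrite yE ltrDl invr_gt0.
  - rewrite yE -addrA lerD2l -mulr2n -[_ *+ 2]mulr_natl ler_pdivrMr//.
    by rewrite mulrC ler_pdivlMr.
  - by rewrite lerDl invr_ge0 ltW.
have dE k : (q k)%:R * x - (p k)%:R = (q k)%:R * (x - (p k)%:R / (q k)%:R).
  by rewrite mulrBr mulrCA divff ?mulr1 ?gt_eqF.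
have eE k : (s k)%:R * y - (r k)%:R = (s k)%:R * (y - (r k)%:R / (s k)%:R).
  by rewrite mulrBr mulrCA divff ?mulr1 ?gt_eqF.
exists x, y, q, p, s, r; split => // k.
- exact: reduced_pair_coprime.
- by rewrite dE mulr_gt0// subr_gt0; have /andP[] := xP k.
- have [_ [_ _ dth qbig] _ _] := nxt k.
  have /andP[x1 x2] := xP k.+1.
  have sM : 0 < ((s k)%:R * M) ^+ n by rewrite exprn_gt0// mulr_gt0.
  rewrite -/(q k) -/(p k) -/(s k) -/(q k.+1) -/(p k.+1) in dth qbig.
  set th := c / _ / _ in dth.
  have -> : ((q k)%:R * x - (p k)%:R) * ((s k)%:R * M) ^+ n - c =
      (q k)%:R * ((s k)%:R * M) ^+ n * (x - (p k)%:R / (q k)%:R - th).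
    by rewrite dE /th; field; rewrite !gt_eqF.
  (* One error 1/q_(k+1) comes from the location of x in its interval, the other from the rounding
     of the increment. *)
  have h : `|x - (p k)%:R / (q k)%:R - th| <= 2 / (q k.+1)%:R.
    by move: dth; rewrite !ler_norml; set a := _ / _ in x1 x2 *; lra.
  rewrite normrM gtr0_norm ?mulr_gt0//.
  apply: le_trans (ler_wpM2l _ h) _; first by rewrite ltW// mulr_gt0.
  rewrite mulrA ler_pdivrMr// [leRHS]mulrC ler_pdivlMr//; apply: le_trans qbig.
  by rewrite le_eqVlt; apply/orP; left; apply/eqP; ring.
- have /andP[y1 _] := yP k; have /andP[_ y2] := yP k.+1; split.
    by rewrite eE mulr_gt0// subr_gt0.
  rewrite yE in y2; rewrite eE.
  have h : y - (r k)%:R / (s k)%:R <= 2 / (s k.+1)%:R by lra.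
  apply: (@le_trans _ _ ((s k)%:R * (2 / (s k.+1)%:R) * (q k.+1)%:R ^+ n)).
    by rewrite ler_wpM2r ?exprn_ge0// ler_pM2l.
  rewrite -[leRHS]mul1r ler_pdivlMr//.
  rewrite [leLHS](_ : _ = 2 * (s k)%:R ^+ 2 * (q k.+1)%:R ^+ n / (s k.+1)%:R); last by ring.
  by rewrite ler_pdivrMr// mul1r.
Qed.

(* The combination m of the proof vanishes only on multiples of the two
   convergents; otherwise the form is at least 1/(qs) up to the errors. *)
Lemma two_variable_lower_bound (R : realType) (x y C : R) (q p s r : nat) (i j z : int) :
  let dl := q%:R * x - p%:R in let ep := s%:R * y - r%:R in
  coprime p q -> coprime r s -> coprime q s -> (0 < q)%N -> (0 < s)%N ->
  0 < dl -> 0 < ep -> 0 <= C ->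
  `|i%:~R| <= C * s%:R -> `|j%:~R| <= C * s%:R ->
  dl + C * s%:R * dl + C * ep <= (q%:R * s%:R)^-1 ->
  dl - C * ep <= `|x * i%:~R + y * j%:~R + z%:~R| \/
  i = 0 /\ exists l : int, j = s%:Z * l.
Proof.
move=> dl ep pq rs qs q0 s0 dl0 ep0 C0 iC jC small.
have qR : 0 < q%:R :> R by rewrite ltr0n.
have sR : 0 < s%:R :> R by rewrite ltr0n.
have q1 : 1 <= q%:R :> R by rewrite ler1n.
have xE : x = (p%:R + dl) / q%:R by rewrite /dl; field; rewrite gt_eqF.
have yE : y = (r%:R + ep) / s%:R by rewrite /ep; field; rewrite gt_eqF.
(* Replacing x and y by p/q and r/s turns the form into m / (q s). *)
pose m : int := i * p%:Z * s%:Z + j * r%:Z * q%:Z + z * q%:Z * s%:Z.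
have LE : x * i%:~R + y * j%:~R + z%:~R =
    m%:~R / (q%:R * s%:R) + (i%:~R * dl / q%:R + j%:~R * ep / s%:R).
  rewrite {1}xE {1}yE /m !intrD !intrM -!pmulrn; field.
  by rewrite !gt_eqF.
have Cep : 0 <= C * ep by rewrite mulr_ge0// ltW.
have [m0|m0] := eqVneq m 0; last first.
  left; have m1 : 1 <= `|m%:~R : R| by rewrite -intr_norm ler1z -gtz0_ge1 normr_gt0.
  have a1 : (q%:R * s%:R)^-1 <= `|m%:~R / (q%:R * s%:R)| :> R.
        have qs0 : 0 < (q%:R * s%:R)^-1 :> R by rewrite invr_gt0 mulr_gt0.
    by rewrite normrM (gtr0_norm qs0) ler_peMl// ltW.
  have a2 : `|i%:~R * dl / q%:R| <= C * s%:R * dl.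
    rewrite normrM normfV (gtr0_norm qR) ler_pdivrMr// normrM (gtr0_norm dl0).
    apply: (@le_trans _ _ (C * s%:R * dl)); first by rewrite ler_pM2r.
    by rewrite ler_peMr// mulr_ge0 ?(ltW dl0)// mulr_ge0.
  have a3 : `|j%:~R * ep / s%:R| <= C * ep.
    by rewrite normrM normfV (gtr0_norm sR) ler_pdivrMr// normrM (gtr0_norm ep0) mulrAC ler_pM2r.
  rewrite LE; have := lerB_normD (m%:~R / (q%:R * s%:R)) (i%:~R * dl / q%:R + j%:~R * ep / s%:R).
  have := ler_normD (i%:~R * dl / q%:R) (j%:~R * ep / s%:R); lra.
(* When m = 0, coprimality forces q to divide i and s to divide j; with i = q i' and j = s l the
   form is then i' dl + l ep. *)
have qi : (q%:Z %| i)%Z.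
  have : (q%:Z %| i * (p%:Z * s%:Z))%Z.
    have -> : i * (p%:Z * s%:Z) = (- (j * r%:Z) - z * s%:Z) * q%:Z by move: m0; rewrite /m; lia.
    exact: dvdz_mull.
  by rewrite Gauss_dvdzl// coprimezE abszM !absz_nat coprimeMr qs andbT coprime_sym.
have sj : (s%:Z %| j)%Z.
  have : (s%:Z %| j * (r%:Z * q%:Z))%Z.
    have -> : j * (r%:Z * q%:Z) = (- (i * p%:Z) - z * q%:Z) * s%:Z by move: m0; rewrite /m; lia.
    exact: dvdz_mull.
  by rewrite Gauss_dvdzl// coprimezE abszM !absz_nat coprimeMr coprime_sym rs coprime_sym.
have [i' iE] := dvdzP qi; have [l jE] := dvdzP sj.
have [i0|i0] := eqVneq i 0; first by right; split => //; exists l; rewrite mulrC.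
left; have i'0 : i' != 0 by apply: contra_neq i0 => i'0; rewrite iE i'0 mul0r.
rewrite LE m0 mul0r add0r iE jE !intrM -!pmulrn.
rewrite (_ : _ + _ = i'%:~R * dl + l%:~R * ep); last by field; rewrite !gt_eqF.
have b1 : dl <= `|i'%:~R * dl|.
  by rewrite normrM (gtr0_norm dl0) ler_peMl ?(ltW dl0)// -intr_norm ler1z -gtz0_ge1 normr_gt0.
have b2 : `|l%:~R * ep| <= C * ep.
  rewrite normrM (gtr0_norm ep0) ler_pM2r//.
  by move: jC; rewrite jE intrM normrM -pmulrn normr_nat ler_pM2r.
have := lerB_normD (i'%:~R * dl) (l%:~R * ep); lra.
Qed.

(** * Reverse Fatou lemma for events, and Bernoulli's inequality *)

(** The upper limit is the decreasing limit of the unions of the G j over j >= k, each of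
    probability at least a once k >= K. *)
Lemma lim_sup_set_probability_ge d (T : measurableType d) (R : realType)
    (P : probability T R) (G : nat -> set T) (K : nat) (a : \bar R) :
  (forall k, measurable (G k)) -> (forall k, (K <= k)%N -> (a <= P (G k))%E) ->
  (a <= P (lim_sup_set G))%E.
Proof.
move=> mG aG.
have mU : measurable (\bigcup_(k >= 0) G k) by exact: bigcup_measurable.
have cvgG := lim_sup_set_cvg P G mG (le_lt_trans (probability_le1 P mU) (ltry 1)).
rewrite -(cvg_lim _ cvgG)//; apply: lime_ge; first by apply/cvg_ex; eexists; exact: cvgG.
near=> k; apply: le_trans (aG k _) _; first by near: k; exists K.
apply: le_measure; rewrite ?inE//; first exact: bigcup_measurable.
by move=> w Gw; exists k => //=.
Unshelve. all: by end_near. Qed.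

Lemma bernoulli_inequality (R : realFieldType) (a : R) (n : nat) :
  0 <= a <= 1 -> 1 - n%:R * a <= (1 - a) ^+ n.
Proof.
move=> /andP[a0 a1]; elim: n => [|n IHn]; first by rewrite mul0r subr0 expr0.
have h : (1 - n%:R * a) * (1 - a) <= (1 - a) ^+ n.+1 by rewrite exprSr ler_wpM2r// subr_ge0.
have : 0 <= n%:R * (a * a) by rewrite !mulr_ge0.
rewrite -natr1; lra.
Qed.

(** * Upper and lower limits at a point with two Liouville-type coordinates *)

Definition mixed_point (R : realType) (m : nat) (x y : R) (v : nat -> R) : 'rV[R]_m.+2 :=
  \row_i match val i with 0 => x | 1 => y | j.+2 => v j end.

Lemma linear_form_mixed_point (R : realType) (m : nat) (x y : R) (v : nat -> R)
    (b : 'rV[int]_m.+2) (z : int) :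
  linear_form (mixed_point m x y v) (b, z) =
  x * (b 0 ord0)%:~R + y * (b 0 (lift ord0 ord0))%:~R +
  \sum_(i < m) v i * (b 0 (lift ord0 (lift ord0 i)))%:~R + z%:~R.
Proof.
rewrite /linear_form/= !big_ord_recl !mxE/= addrA; congr (_ + _ + _).
by apply: eq_bigr => i _; rewrite mxE.
Qed.

Lemma large_index (R : realType) (q s : nat -> nat) (a : R) :
  (forall k, [/\ (k < q k)%N, (q k < s k)%N & (s k < q k.+1)%N]) ->
  exists K, forall k, (K <= k)%N -> [/\ a <= (q k)%:R, a <= (s k)%:R & a <= (q k.+1)%:R].
Proof.
move=> lt_qs; exists (Num.truncn a).+1 => k Kk; have [kq qs sq] := lt_qs k.
have ak : a <= k%:R by apply: le_trans (ltW (truncnS_gt _)) _; rewrite ler_nat.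
by split; apply: le_trans ak _; rewrite ler_nat; [|apply: ltnW..]; lia.
Qed.

Section MixedPoint.
Variables (R : realType) (m : nat) (N : 'rV[R]_m.+2 -> R).
Hypothesis normN : is_norm N.
Let M0 : R := N (delta_mx 0 ord0).
Let M : R := N (delta_mx 0 (lift ord0 ord0)).

Variables (c x y : R) (q p s r : nat -> nat).
Hypotheses (c_ge0 : 0 <= c)
  (lt_qs : forall k, [/\ (k < q k)%N, (q k < s k)%N & (s k < q k.+1)%N]).
Let dl k := (q k)%:R * x - (p k)%:R.
Let ep k := (s k)%:R * y - (r k)%:R.
Hypotheses (dl_gt0 : forall k, 0 < dl k)
  (dl_near : forall k, `|dl k * ((s k)%:R * M) ^+ m.+2 - c| <= (s k)%:R^-1)
  (epP : forall k, 0 < ep k /\ ep k * (q k.+1)%:R ^+ m.+2 <= (s k)%:R^-1).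
Variable v : nat -> R.
Let xi := mixed_point m x y v.

Let delta_mx_neq0 i : delta_mx 0 i != 0 :> 'rV[R]_m.+2.
Proof. by apply/eqP => /rowP/(_ i)/eqP; rewrite !mxE !eqxx oner_eq0. Qed.
Let M0_gt0 : 0 < M0. Proof. exact/is_norm_gt0/delta_mx_neq0. Qed.
Let M_gt0 : 0 < M. Proof. exact/is_norm_gt0/delta_mx_neq0. Qed.
Let q_gt0 k : 0 < (q k)%:R :> R.
Proof. by have [kq _ _] := lt_qs k; rewrite ltr0n (leq_trans _ kq). Qed.
Let s_gt0 k : 0 < (s k)%:R :> R.
Proof. by have [kq qs _] := lt_qs k; rewrite ltr0n (leq_trans _ qs). Qed.

Let norm_axis i (a : nat) : N (map_mx intr (a%:Z *: delta_mx 0 i)) = a%:R * N (delta_mx 0 i).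
Proof.
rewrite -[in RHS](ger0_norm (ler0n R a)) -is_norm_homogeneous//; congr N.
by apply/rowP => j; rewrite !mxE intrM -pmulrn; case: (_ && _).
Qed.

Let form_q k : linear_form xi ((q k)%:Z *: delta_mx 0 ord0, - (p k)%:Z) = dl k.
Proof.
rewrite linear_form_mixed_point !mxE/= mulr0 big1 => [|i _]; last by rewrite !mxE/= !mulr0.
by rewrite mulr0 mulr1 !addr0 intrN mulrC.
Qed.

Let form_s k : linear_form xi ((s k)%:Z *: delta_mx 0 (lift ord0 ord0), - (r k)%:Z) = ep k.
Proof.
rewrite linear_form_mixed_point !mxE/= mulr0 big1 => [|i _]; last by rewrite !mxE/= !mulr0.
by rewrite mulr0 mulr1 !(addr0, add0r) intrN mulrC.
Qed.

(** Let q_k M0 <= t < q_(k+1) M0 and n = m + 2. If t < s_k M, the point q_k e_1 gives at most dl_k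
    (s_k M)^n <= c + 1/s_k; otherwise s_k e_2 gives at most ep_k (q_(k+1) M0)^n <= M0^n / s_k. *)
Lemma Theta_mixed_point_le : (Theta N xi <= c%:E)%E.
Proof.
apply/lee_addgt0Pr => e e0; rewrite -EFinD.
(* Each summand secures one requirement: both points have norm at least 1, 1/s_k <= e, and M0^n /
   s_k <= e. *)
have [K KP] := large_index (M0^-1 + M^-1 + e^-1 + M0 ^+ m.+2 / e) lt_qs.
apply: (@Theta_le _ _ _ _ ((q K)%:R * M0)); first by rewrite mulr_ge0 ?ltW.
move=> t Kt; have t0 : 0 < t by apply: lt_trans Kt; rewrite mulr_gt0.
have ex : exists j, t < (q (K + j).+1)%:R * M0.
  have [j jP] := large_index (t / M0 + 1) lt_qs; exists j.
  rewrite -ltr_pdivrMr//; have [_ _] := jP (K + j)%N (leq_addl _ _); lra.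
(* The lower bound q_k M0 <= t follows from minimality of [j], or from the assumption on t when [j]
   is 0. *)
pose j := ex_minn ex; pose k := (K + j)%N.
have [qt tq] : (q k)%:R * M0 <= t /\ t < (q k.+1)%:R * M0.
  rewrite /k /j; case: ex_minnP => -[|i] ti imin; split => //.
    by rewrite addn0 ltW.
  by rewrite leNgt; apply/negP => ti'; have := imin i; rewrite -addnS ti' ltnn => /(_ isT).
have [aq as_ _] := KP k (leq_addr _ _).
have [iM0 iM ie Me] : [/\ 0 < M0^-1, 0 < M^-1, 0 < e^-1 & 0 < M0 ^+ m.+2 / e].
  by rewrite !invr_gt0 divr_gt0 ?exprn_gt0.
have qM0 : 1 <= (q k)%:R * M0 by rewrite -ler_pdivrMr// mul1r; lra.
have sM : 1 <= (s k)%:R * M by rewrite -ler_pdivrMr// mul1r; lra.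
have es : (s k)%:R^-1 <= e by rewrite -[e]invrK lef_pV2 ?posrE//; lra.
have Ms : M0 ^+ m.+2 / (s k)%:R <= e by rewrite ler_pdivrMr// mulrC -ler_pdivrMr//; lra.
have [tsM|sMt] := ltP t ((s k)%:R * M).
  exists ((q k)%:Z *: delta_mx 0 ord0, - (p k)%:Z); first by rewrite /admissible/= norm_axis qM0.
  rewrite form_q gtr0_norm//.
  apply: (@le_trans _ _ (dl k * ((s k)%:R * M) ^+ m.+2)).
    by rewrite mulrC ler_pM2l// lerXn2r ?nnegrE ?mulr_ge0 ?ltW// (lt_trans t0).
  by have := dl_near k; rewrite ler_norml; lra.
have [ep0 epq] := epP k.
exists ((s k)%:Z *: delta_mx 0 (lift ord0 ord0), - (r k)%:Z).
  by rewrite /admissible/= norm_axis sM.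
rewrite form_s gtr0_norm//.
apply: (@le_trans _ _ (ep k * ((q k.+1)%:R * M0) ^+ m.+2)).
  by rewrite mulrC ler_pM2l// lerXn2r ?nnegrE ?mulr_ge0 ?ltW// (lt_trans t0).
have M0n : 0 <= M0 ^+ m.+2 by rewrite exprn_ge0// ltW.
rewrite exprMn mulrA (le_trans (ler_wpM2r M0n epq))//.
by rewrite [leLHS]mulrC (le_trans Ms)// lerDr.
Qed.

Let ep_s k : ep k * (s k)%:R ^+ m.+2 <= (s k)%:R^-1.
Proof.
have [ep0 epq] := epP k; apply: le_trans epq; rewrite ler_pM2l// lerXn2r ?nnegrE//.
by rewrite ler_nat ltnW//; have [] := lt_qs k.
Qed.

(** At height t = s_K M, the point s_K e_2 gives t^n ep_K <= M^n / s_K with n = m + 2, which is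
    arbitrarily small. *)
Lemma Theta_low_mixed_point_le0 : (Theta_low N xi <= 0)%E.
Proof.
apply: Theta_low_le0 => T0 e e0.
have [K KP] := large_index (M^-1 + (`|T0| + 1) / M + M ^+ m.+2 / e) lt_qs.
have [_ as_ _] := KP K (leqnn _).
have [iM iT Me] : [/\ 0 < M^-1, 0 < (`|T0| + 1) / M & 0 < M ^+ m.+2 / e].
  by rewrite invr_gt0 !divr_gt0 ?exprn_gt0// ltr_wpDl.
have sM : 1 <= (s K)%:R * M by rewrite -ler_pdivrMr// mul1r; lra.
exists ((s K)%:R * M), ((s K)%:Z *: delta_mx 0 (lift ord0 ord0), - (r K)%:Z); split.
- have : `|T0| + 1 <= (s K)%:R * M by rewrite -ler_pdivrMr//; lra.
  by have := ler_norm T0; lra.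
- by rewrite /admissible/= norm_axis sM lexx.
have [ep0 epq] := epP K.
rewrite form_s gtr0_norm// exprMn mulrAC.
apply: (@le_trans _ _ ((s K)%:R^-1 * M ^+ m.+2)).
  by rewrite ler_wpM2r ?(exprn_ge0 _ (ltW M_gt0))// mulrC ep_s.
by rewrite mulrC ler_pdivrMr// mulrC -ler_pdivrMr//; lra.
Qed.

Hypotheses (m_ge2 : (2 <= m)%N)
  (coprime_pqrs : forall k, [/\ coprime (p k) (q k), coprime (r k) (s k) & coprime (q k) (s k)]).

(** Test at t = (s_k - 1) M, just below the norm of s_k e_2. Points involving the coordinates [v]
    are covered by the hypothesis, the others by [two_variable_lower_bound]. All values are at least
    dl_k - D ep_k, and t^n times this tends to c. *)
Lemma Theta_mixed_point_ge (D : nat) :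
  (forall (b : 'rV[R]_m.+2) i, `|b 0 i| * M <= D%:R * N b) ->
  (forall K, exists2 k, (K <= k)%N & forall (b : 'rV[int]_m.+2) z,
     (exists i : 'I_m, b 0 (lift ord0 (lift ord0 i)) != 0) ->
     (forall i, `|b 0 i| <= (D * s k)%:Z) -> dl k <= `|linear_form xi (b, z)|) ->
  (c%:E <= Theta N xi)%E.
Proof.
move=> ND good; apply/lee_subgt0Pr => e e0; rewrite -EFinB.
have Mn : 0 < M ^+ m.+2 by rewrite exprn_gt0.
pose A := (c + 1) / M ^+ m.+2.
have A0 : 0 <= A by rewrite divr_ge0 ?addr_ge0// ltW.
have D0 : 0 <= D%:R :> R by [].
apply: Theta_ge => T0.
(* The total loss is at most W / s_k: 1 from the tuning of dl_k, D M^n from ep_k, and n c from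
   replacing s_k by s_k - 1, where n = m + 2. *)
pose W := 1 + D%:R * M ^+ m.+2 + m.+2%:R * c.
have Mn_ge0 := ltW Mn.
have W0 : 0 <= W by rewrite !addr_ge0// mulr_ge0.
pose a0 := 2 + A + D%:R * A + D%:R + W / e + (`|T0| + 1) / M.
have [K KP] := large_index a0 lt_qs; have [k Kk kgood] := good K.
have [_ + _] := KP k Kk; set S : R := (s k)%:R; move=> aS.
have DA : 0 <= D%:R * A by rewrite mulr_ge0.
have We : 0 <= W / e by rewrite divr_ge0// ltW.
have TM : 0 <= (`|T0| + 1) / M by rewrite divr_ge0 ?addr_ge0// ltW.
have S1 : 1 <= S by rewrite /a0 in aS; lra.
have S0 : 0 < S by exact: lt_le_trans S1.
pose Sn := S ^+ m.+2.
have Sn0 : 0 < Sn by rewrite exprn_gt0.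
have [ep0 _] := epP k.
have dlS : dl k * Sn <= A.
  have := dl_near k; rewrite exprMn -/S -/Sn ler_norml => /andP[_ h].
  have : S^-1 <= 1 by rewrite invf_le1.
  rewrite /A ler_pdivlMr// -mulrA; lra.
have epS : ep k * Sn <= S^-1 by exact: ep_s.
have epS1 : ep k * Sn <= 1 by apply: le_trans epS _; rewrite invf_le1.
have small : dl k + D%:R * S * dl k + D%:R * ep k <= ((q k)%:R * S)^-1.
  apply: (@le_trans _ _ (S ^+ 2)^-1); last first.
    rewrite lef_pV2 ?posrE ?mulr_gt0 ?exprn_gt0// expr2 ler_pM2r// ler_nat ltnW//.
    by have [] := lt_qs k.
  rewrite -[leRHS]mul1r ler_pdivlMr ?exprn_gt0//.
  have : (dl k + D%:R * S * dl k + D%:R * ep k) * Sn <= S ^+ 2.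
    have := ler_wpM2l (mulr_ge0 D0 (ltW S0)) dlS; have := ler_wpM2l D0 epS1.
    have : A + D%:R * A + D%:R <= S by rewrite /a0 in aS; lra.
    move=> h; have := ler_wpM2r (ltW S0) h.
    have : A <= A * S by rewrite ler_peMr.
    have : D%:R <= D%:R * S by rewrite ler_peMr.
    rewrite expr2; lra.
  (* Here m >= 2 enters: the error is at most S^2 / S^n with n = m + 2 >= 4, hence at most S^-2,
     which is below 1 / (q_k S). *)
  have : S ^+ 4 <= Sn by rewrite ler_weXn2l//.
  set tot := dl k + _ + _.
  have tot0 : 0 <= tot.
    have := mulr_ge0 (mulr_ge0 D0 (ltW S0)) (ltW (dl_gt0 k)).
    by have := mulr_ge0 D0 (ltW ep0); have := dl_gt0 k; rewrite /tot; lra.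
  move=> S4 totS; have : tot * S ^+ 4 <= S ^+ 2 by apply: le_trans totS; rewrite ler_wpM2l.
  by rewrite (exprD S 2 2) mulrA ger_pMl ?exprn_gt0.
exists ((S - 1) * M).
  have : `|T0| + 1 <= (S - 1) * M by rewrite -ler_pdivrMr// /a0 in aS *; lra.
  by have := ler_norm T0; lra.
move=> [b z] /andP[/= Nb1 Nb2].
have NS : N (map_mx intr b) < S * M by apply: le_lt_trans Nb2 _; rewrite ltr_pM2r// ltrBlDl ltrDr.
have bD i : `|(b 0 i)%:~R : R| <= D%:R * S.
  rewrite -(ler_pM2r M_gt0) -mulrA; have := ND (map_mx intr b) i; rewrite mxE => h.
  by apply: le_trans h _; rewrite ler_wpM2l// ltW.
have Lge : dl k - D%:R * ep k <= `|linear_form xi (b, z)|.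
  have [bt|/forallNP bt] := pselect (exists i : 'I_m, b 0 (lift ord0 (lift ord0 i)) != 0).
    apply: (@le_trans _ _ (dl k)); first by rewrite gerBl mulr_ge0// ltW.
    apply: kgood => // i; have := bD i.
    by rewrite -natrM -intr_norm -[(D * s k)%:R]/((D * s k)%:Z%:~R) ler_int.
  have bt0 i : b 0 (lift ord0 (lift ord0 i)) = 0.
    by apply/eqP; rewrite -[_ == _]negbK; apply/negP/bt.
  rewrite linear_form_mixed_point big1 ?addr0 => [|i _]; last by rewrite bt0 mulr0.
  have [pq rs qs] := coprime_pqrs k.
  have q0 : (0 < q k)%N by rewrite -(ltr_nat R).
  have s0 : (0 < s k)%N by rewrite -(ltr_nat R).
  have [h|[b0 [l bl]]] :=
    two_variable_lower_bound z pq rs qs q0 s0 (dl_gt0 k) ep0 D0 (bD ord0)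
      (bD (lift ord0 ord0)) small.
    exact: h.
  have bE : map_mx intr b = (s k)%:R *: (l%:~R *: delta_mx 0 (lift ord0 ord0)) :> 'rV[R]_m.+2.
    apply/rowP => i; rewrite !mxE/=.
    case: (unliftP ord0 i) => [i'|] ->; last by rewrite b0 !mulr0.
    case: (unliftP ord0 i') => [i''|] ->; last by rewrite bl eqxx !mulr1 intrM.
    by rewrite bt0 (inj_eq lift_inj) !mulr0.
  (* The exceptional points l s_k e_2 are not admissible: the norm is 0 for l = 0 and at least s_k M
     otherwise. *)
  move: Nb1 NS; rewrite bE !is_norm_homogeneous// -/M normr_nat ltr_pM2l//.
  have [->|l0] := eqVneq l 0; first by rewrite normr0 mul0r mulr0 ler10.
  move=> _; rewrite gtr_pMl// -intr_norm ltrz1 => /lt_geF; rewrite -gtz0_ge1 normr_gt0.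
  by rewrite l0.
pose V := c - (1 + D%:R * M ^+ m.+2) / S.
have VL : V <= (S * M) ^+ m.+2 * (dl k - D%:R * ep k).
  have := dl_near k; rewrite -/S ler_norml => /andP[h _].
  have : D%:R * M ^+ m.+2 * (ep k * Sn) <= D%:R * M ^+ m.+2 * S^-1.
    by rewrite ler_wpM2l// mulr_ge0.
  rewrite /V; move: h; rewrite !exprMn -/Sn; lra.
have S1M : 0 <= ((S - 1) * M) ^+ m.+2 by rewrite exprn_ge0// mulr_ge0 ?(ltW M_gt0)// subr_ge0.
have WS : W / S <= e.
  by rewrite ler_pdivrMr// mulrC -ler_pdivrMr// /a0 in aS *; lra.
(* If V < 0, then c - e is negative as well and there is nothing to gain from the form. *)
have [V0|V0] := ltP V 0.
  apply: (@le_trans _ _ 0); last by rewrite mulr_ge0.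
  apply: le_trans (ltW V0); rewrite /V lerD2l lerN2; apply: le_trans WS.
  by rewrite ler_pM2r ?invr_gt0// /W lerDl mulr_ge0.
apply: (@le_trans _ _ (((S - 1) * M) ^+ m.+2 * (dl k - D%:R * ep k))); last by rewrite ler_wpM2l.
have -> : (S - 1) * M = (1 - S^-1) * (S * M) by field; rewrite gt_eqF.
rewrite exprMn -mulrA.
have Bern : 1 - m.+2%:R * S^-1 <= (1 - S^-1) ^+ m.+2.
  by apply: bernoulli_inequality; rewrite invr_ge0 (ltW S0) invf_le1.
apply: (@le_trans _ _ ((1 - S^-1) ^+ m.+2 * V)); last first.
  by rewrite ler_wpM2l// exprn_ge0// subr_ge0 invf_le1.
apply: (@le_trans _ _ ((1 - m.+2%:R * S^-1) * V)); last by rewrite ler_wpM2r.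
have : m.+2%:R * S^-1 * V <= m.+2%:R * S^-1 * c.
  rewrite ler_wpM2l ?mulr_ge0 ?invr_ge0 ?(ltW S0)// /V gerBl divr_ge0 ?(ltW S0)//.
  by rewrite addr_ge0// mulr_ge0.
move: WS; rewrite /W /V; lra.
Qed.

End MixedPoint.

(** * Union bound over near resonances *)

Lemma finite_union_probability_le d (T : measurableType d) (R : realType)
    (P : probability T R) (I : finType) (A : I -> set T) (c : R) :
  (forall i, measurable (A i)) -> (forall i, (P (A i) <= c%:E)%E) ->
  measurable (\bigcup_i A i) /\ (P (\bigcup_i A i) <= (#|I|%:R * c)%:E)%E.
Proof.
move=> mA Ac; have -> : \bigcup_i A i = \big[setU/set0]_(i <- enum I) A i.
  rewrite -bigcup_seq; apply/seteqP; split=> w [i _ Aiw]; exists i => //.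
  by rewrite /= mem_enum.
rewrite cardE; elim: (enum I) => [|i l [mU PU]].
  by rewrite big_nil measure0 mul0r.
rewrite big_cons /=; split; first exact: measurableU.
apply: (@le_trans _ _ (P (A i) + P (\big[setU/set0]_(j <- l) A j))%E); first exact: measureU2.
by rewrite -natr1 mulrDl mul1r addrC EFinD leeD.
Qed.

(** There are (2 D + 1)^(m+2) vectors b with entries in [-D, D]. For each one involving a random
    coordinate, all constant terms z together cost at most 6 dl; x and y only contribute to the
    shift [al]. *)
Lemma near_resonance_probability d (T : measurableType d) (R : realType) (m : nat)
    (P : probability T R) (X : nat -> T -> R) (x y : R) (D : nat) (dl : R) :
  (forall i, measurable_fun setT (X i)) ->
  (forall (b : nat -> int) (al dl : R), 0 <= dl -> (exists2 i, (i < m)%N & b i != 0) ->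
    (P [set w | exists z : int,
       (`|\sum_(i < m) (b i)%:~R * X i w + al + z%:~R| < dl)%R] <= (6 * dl)%:E)%E) ->
  0 <= dl ->
  let bad := [set w | exists (b : 'rV[int]_m.+2) z,
    [/\ exists i : 'I_m, b 0 (lift ord0 (lift ord0 i)) != 0, forall i, `|b 0 i| <= D%:Z &
        `|linear_form (mixed_point m x y (X ^~ w)) (b, z)| < dl]] in
  measurable bad /\ (P bad <= ((2 * D + 1)%:R ^+ m.+2 * (6 * dl))%:E)%E.
Proof.
move=> mX Xint dl0 bad.
pose vec (u : {ffun 'I_m.+2 -> 'I_(2 * D + 1)}) : 'rV[int]_m.+2 := \row_i ((u i)%:Z - D%:Z).
pose ok (b : 'rV[int]_m.+2) := exists i : 'I_m, b 0 (lift ord0 (lift ord0 i)) != 0.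
pose A u := [set w | ok (vec u) /\ exists z,
  `|linear_form (mixed_point m x y (X ^~ w)) (vec u, z)| < dl].
have mform b z : measurable [set w | `|linear_form (mixed_point m x y (X ^~ w)) (b, z)| < dl].
  apply: measurable_norm_lt.
  under eq_fun do rewrite linear_form_mixed_point.
  apply: measurable_funD => //; apply: measurable_funD => //.
  by apply: measurable_sum => i; exact: measurable_funM.
have mA u : measurable (A u).
  have [oku|nok] := pselect (ok (vec u)); last first.
    by rewrite (_ : A u = set0)//; apply/seteqP; split=> w // [].
  rewrite (_ : A u = [set w | exists z,
      `|linear_form (mixed_point m x y (X ^~ w)) (vec u, z)| < dl]).
    by apply: measurable_exists_int => z; exact: mform.
  by apply/seteqP; split=> w // [].
have PA u : (P (A u) <= (6 * dl)%:E)%E.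
  have [oku|nok] := pselect (ok (vec u)); last first.
    rewrite (_ : A u = set0); last by apply/seteqP; split=> w // [].
    by rewrite measure0 lee_fin mulr_ge0.
  pose b i := vec u 0 (inord i.+2).
  have bE (i : 'I_m) : b i = vec u 0 (lift ord0 (lift ord0 i)).
    by rewrite /b; congr (_ _ _); apply: val_inj; rewrite /= inordK// !ltnS.
  pose al := x * (vec u 0 ord0)%:~R + y * (vec u 0 (lift ord0 ord0))%:~R.
  have formE w z : linear_form (mixed_point m x y (X ^~ w)) (vec u, z) =
      \sum_(i < m) (b i)%:~R * X i w + al + z%:~R.
    rewrite linear_form_mixed_point -/al [al + _]addrC; congr (_ + _ + _).
    by apply: eq_bigr => i _; rewrite bE mulrC.
  rewrite (_ : A u = [set w | exists z : int,
      (`|\sum_(i < m) (b i)%:~R * X i w + al + z%:~R| < dl)%R]).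
    by apply: Xint => //; have [i ui] := oku; exists i; rewrite ?bE.
  by apply/seteqP; split=> [w [_ [z zw]]|w [z zw]];
    [exists z; rewrite -formE|split => //; exists z; rewrite formE].
have [mU PU] := finite_union_probability_le mA PA.
have -> : bad = \bigcup_u A u.
  apply/seteqP; split=> [w [b [z [okb bD bz]]]|w [u _ [oku [z zw]]]]; last first.
    exists (vec u), z; split => // i; rewrite mxE.
    by have := ltn_ord (u i); move: (u i : nat) => a; rewrite ler_norml; lia.
  have bD' i : (`|(b 0%R i + D%:Z)%R| < 2 * D + 1)%N.
    by have := bD i; rewrite ler_norml; lia.
  have vecE : vec [ffun i => Ordinal (bD' i)] = b.
    apply/rowP => i; rewrite mxE ffunE /=; have := bD i; rewrite ler_norml; lia.
  by exists [ffun i => Ordinal (bD' i)] => //; split; rewrite ?vecE//; exists z.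
by split => //; rewrite card_ffun !card_ord natrX in PU.
Qed.

(** * Positive probability of the good event and the dimension bound *)

Lemma euclidean_dist_ge_coord (R : realType) n (a b : 'rV[R]_n) i :
  `|b 0 i - a 0 i| <= euclidean_dist a b.
Proof.
rewrite -(sqrtr_sqr (b 0 i - a 0 i)) ler_wsqrtr// (bigD1 i)//= -sqrrN opprB lerDl.
by apply: sumr_ge0 => j _; exact: sqr_ge0.
Qed.

(** The random coordinates avoid all competing integer points for infinitely many k with positive
    probability, and the mass distribution principle applies to the resulting points. Stating the
    bound for all supersets B serves [FS] and [DI] at once; nonemptiness puts c in the spectrum. *)
Lemma FS_dimension (R : realType) (m : nat) (N : 'rV[R]_m.+2 -> R) :
  is_norm N -> (2 <= m)%N ->
  exists2 cn : R, 0 < cn & forall c, 0 <= c <= cn ->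
    FS N c !=set0 /\ forall B, FS N c `<=` B -> (m%:R%:E <= dimH B)%E.
Proof.
move=> normN m_ge2.
have [k0 k00 Nk0] := is_norm_ge_coord normN.
pose M := N (delta_mx 0 (lift ord0 ord0)).
have M0 : 0 < M.
  apply: is_norm_gt0 => //; apply/eqP => /rowP/(_ (lift ord0 ord0))/eqP.
  by rewrite !mxE !eqxx oner_eq0.
(* Chosen so that integer points of norm at most s_k M have coordinates at most D s_k. *)
pose D := (Num.truncn (M / k0)).+1.
have D1 : 1 <= D%:R :> R by rewrite ler1n.
have ND (b : 'rV[R]_m.+2) i : `|b 0 i| * M <= D%:R * N b.
  have : M <= D%:R * k0 by rewrite -ler_pdivrMr// ltW// truncnS_gt.
  have := Nk0 b i; have := normr_ge0 (b 0 i); set t := `|_| => t0 tN MD.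
  apply: (@le_trans _ _ (t * (D%:R * k0))); first exact: ler_wpM2l.
  by rewrite mulrCA ler_wpM2l// mulrC.
have Mn : 0 < M ^+ m.+2 by rewrite exprn_gt0.
pose H : R := 12 * (3 * D%:R) ^+ m.+2.
have D3 : 1 <= (3 * D%:R) ^+ m.+2 :> R by rewrite exprn_ege1//; lra.
have H1 : 1 <= H by rewrite /H; lra.
have H0 : 0 < H by lra.
(* With n = m + 2, the union bound is at most (3 D s_k)^n 6 dl_k, and dl_k (s_k M)^n <= c + 1/s_k <=
   2 cn for large k. This gives H cn / M^n, which the choice of [cn] makes equal to 1/2. *)
pose cn := M ^+ m.+2 / (2 * H).
have cn0 : 0 < cn by rewrite divr_gt0// mulr_gt0.
exists cn => // c /andP[c0 ccn].
have cM : 2 * c <= M ^+ m.+2.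
  have : 2 * cn <= M ^+ m.+2.
    have -> : 2 * cn = M ^+ m.+2 / H by rewrite /cn; field; rewrite gt_eqF.
    by rewrite ler_pdivrMr// ler_peMr// ltW.
  lra.
have [x [y [q [p [s [r [cop lt_qs dl0 dlP epP]]]]]]] := liouville_pair (ltn0Sn m.+1) M0 c0 cM.
have [d [T [P [X [mX Xbox Xint]]]]] := uniform_cube R m.
pose dl k := (q k)%:R * x - (p k)%:R.
pose xi w := mixed_point m x y (X ^~ w).
pose bad k := [set w | exists (b : 'rV[int]_m.+2) z,
    [/\ exists i : 'I_m, b 0 (lift ord0 (lift ord0 i)) != 0,
        forall i, `|b 0 i| <= (D * s k)%:Z & `|linear_form (xi w) (b, z)| < dl k]].
have badP k : measurable (bad k) /\
    (P (bad k) <= ((2 * (D * s k) + 1)%:R ^+ m.+2 * (6 * dl k))%:E)%E.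
  by apply: near_resonance_probability => //; exact/ltW/dl0.
have [K KP] := large_index cn^-1 lt_qs.
have badh k : (K <= k)%N -> (P (bad k) <= (2^-1)%:E)%E.
  move=> Kk; have [_ Pbad] := badP k; apply: le_trans Pbad _; rewrite lee_fin.
  have [_ sk _] := KP k Kk.
  have s0 : 0 < (s k)%:R :> R by apply: lt_le_trans sk; rewrite invr_gt0.
  have scn : (s k)%:R^-1 <= cn by rewrite -[cn]invrK lef_pV2 ?posrE ?invr_gt0.
  have dlM : dl k * ((s k)%:R * M) ^+ m.+2 <= 2 * cn.
    by have := dlP k; rewrite -/(dl k) ler_norml; lra.
  apply: (@le_trans _ _ ((3 * D%:R * (s k)%:R) ^+ m.+2 * (6 * dl k))).
    apply: ler_wpM2r; first by rewrite mulr_ge0// (ltW (dl0 k)).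
    rewrite lerXn2r ?nnegrE ?mulr_ge0//.
    rewrite -!natrM ler_nat -mulnA -[X in (_ <= X * _)%N]/(2 + 1)%N mulnDl mul1n leq_add2l.
    by rewrite muln_gt0/= -(ltr_nat R).
  rewrite exprMn [leLHS](_ : _ = H * (dl k * ((s k)%:R * M) ^+ m.+2) / (2 * M ^+ m.+2)); last first.
    by rewrite /H [(_ * M) ^+ _]exprMn; field; rewrite gt_eqF.
  have M2 : 0 < 2 * M ^+ m.+2 by rewrite mulr_gt0.
  rewrite ler_pdivrMr//; apply: le_trans (ler_wpM2l (ltW H0) dlM) _.
  rewrite le_eqVlt; apply/orP; left; apply/eqP.
  by rewrite /cn; field; rewrite gt_eqF.
(* The good indices k depend on the point, so only infinitely many of them are asked for; this is
   all that an upper limit needs. *)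
pose E := lim_sup_set (fun k => ~` bad k).
have mG k : measurable (~` bad k) by apply: measurableC; have [] := badP k.
have mE : measurable E.
  by apply: bigcap_measurableType => k _; apply: bigcup_measurable => j _; exact: mG.
have PE : (0 < P E)%E.
  apply: lt_le_trans (_ : (2^-1)%:E <= _)%E; first by rewrite lte_fin.
  apply: (lim_sup_set_probability_ge (K := K)) => // k Kk.
  rewrite probability_setC; last by have [] := badP k.
  have Pb := badh k Kk.
  have Pf : P (bad k) \is a fin_num by apply: fin_num_measure; have [] := badP k.
  rewrite -(fineK Pf) -EFinB lee_fin; move: Pb; rewrite -(fineK Pf) lee_fin; lra.
have EFS w : E w -> FS N c (xi w).
  move=> Ew; split.
    apply/eqP; rewrite eq_le; apply/andP; split.
      exact: (Theta_mixed_point_le normN c0 lt_qs dl0 dlP epP).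
    apply: (Theta_mixed_point_ge normN c0 lt_qs dl0 dlP epP m_ge2 cop ND) => k.
    have [j /= kj Gj] := Ew k I; exists j => // b z bt bD.
    rewrite leNgt; apply/negP => bz; apply: Gj; by exists b, z.
  rewrite /Bad/=; apply/negP; rewrite -leNgt.
  exact: (Theta_low_mixed_point_le0 normN x lt_qs epP).
split.
  have [w Ew] : E !=set0.
    apply/set0P/eqP => E0; by rewrite E0 measure0 ltxx in PE.
  by exists (xi w); exact: EFS.
(* A ball of radius rho projects into a cube of side 2 rho in the random coordinates, whence C =
   2^m. *)
move=> B FSB; apply: (hausdorff_dim_ge (Y := xi) (C := 2 ^+ m) mE PE) => //.
- by move=> w /EFS/FSB.
- move=> a rho rho0.
  pose a' i := a 0 (inord i.+2).
  exists [set w | forall i, (i < m)%N -> (`|X i w - a' i| <= rho)%R]; split.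
  + exact: measurable_box.
  + move=> w dw i im; apply: le_trans dw.
    apply: le_trans (euclidean_dist_ge_coord _ _ (inord i.+2)).
    by rewrite mxE [val _]inordK// !ltnS.
  + by rewrite -exprMn; exact: Xbox.
Qed.

Theorem theorem2p3 (R : realType) (n : nat) (N : 'rV[R]_n -> R)
    (n_ge4 : (4 <= n)%N) (normN : is_norm N) :
  exists2 cn : R, 0 < cn &
    [/\ (forall c : R, 0 <= c <= cn -> ((n%:R - 2)%:E <= dimH (FS N c))%E),
        (dirichlet_sup N < +oo)%E,
        dirichlet_spectrum N `<=` [set x | (0 <= x <= dirichlet_sup N)%E],
        (exists2 e : R, 0 < e &
           forall c : R, 0 <= c < e -> dirichlet_spectrum N c%:E) &
        (forall c : R, 0 <= c <= cn -> ((n%:R - 2)%:E <= dimH (DI N c))%E)].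
Proof.
(* Write n = m + 2, with two Liouville-type coordinates and m >= 2 random ones. *)
case: n N n_ge4 normN => [|[|m]] N // n_ge4 normN.
have [cn cn0 FScn] := FS_dimension normN n_ge4.
have mE : m.+2%:R - 2 = m%:R :> R by rewrite -addn2 natrD addrK.
exists cn => //; rewrite mE; split.
- by move=> c /FScn[_]; apply.
- exact: dirichlet_sup_lty.
- move=> _ [xi _ <-]; rewrite /= Theta_ge0/=.
  by apply: ereal_sup_ubound; exists xi.
- exists cn => // c /andP[c0 ccn].
  have [|[xi [xic _]] _] := FScn c; first by rewrite c0 ltW.
  by exists xi.
- by move=> c /FScn[_]; apply => xi [].
Qed.
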